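(* Consider the scalar two-player $\gamma$-discounted linear quadratic game with $a\neq0$, $\gamma\in(0,1]$, $\sigma_1,\sigma_2\ge 0$, $r_1,r_2>0$, and let $(x_i^\star,x_{-i}^\star)$ be a stable Feedback Nash Equilibrium with nonzero policies. Then it is locally saddle if and only if $C(x_i^\star,x_{-i}^\star)<0$, where $$C(x_i,x_{-i})=h_-^{\prime(i)}(x_i)\,h_-^{\prime(-i)}(x_{-i})-1$$ and $h_-^{\prime(i)}$ is the derivative of $h_-^{(i)}$.
   Context: For a player index $i\in\{1,2\}$, $-i$ denotes the other player. The game: the scalar state evolves as $s_{t+1}=a s_t+u_{1,t}+u_{2,t}$, $t=0,1,2,\dots$, with $a\in\mathbb{R}$, and each player uses a linear feedback $u_{i,t}=x_i s_t$ with policy $x_i\in\mathbb{R}$. For $x=(x_1,x_2)$ put $a_{\mathrm{cl}}(x)=a+x_1+x_2$, so $s_t=a_{\mathrm{cl}}(x)^t s_0$. Player $i$'s value function is $$V^{(i)}(s_0;x_i,x_{-i})=\sum_{t=0}^\infty \gamma^t r_i(\sigma_i s_t^2+u_{i,t}^2)=s_0^2 r_i(\sigma_i+x_i^2)\sum_{t=0}^\infty(\gamma a_{\mathrm{cl}}^2(x))^t\in[0,\infty].$$ A pair $x^\star=(x_1^\star,x_2^\star)\in\mathbb{R}^2$ is a Feedback Nash Equilibrium (FNE) if for all $s_0\in\mathbb{R}$, each player $i$ and each $x_i\in\mathbb{R}$, $V^{(i)}(s_0;x_i^\star,x_{-i}^\star)\le V^{(i)}(s_0;x_i,x_{-i}^\star)$.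 It is a stable FNE if in addition $|a_{\mathrm{cl}}(x^\star)|<1$. For $x\neq0$ define $$h_\pm^{(i)}(x)=\frac{\sigma_i-x(2a+x)}{2x}\pm\frac{\sqrt{\gamma^2(\sigma_i+x^2)^2+4\gamma x^2}}{2\gamma x}.$$ Let $F=(F_i,F_{-i})$ with $F_i(x_i,x_{-i})=\gamma x_i\,(x_{-i}-h_-^{(i)}(x_i))(x_{-i}-h_+^{(i)}(x_i))$ and $F_{-i}(x_i,x_{-i})=\gamma x_{-i}\,(x_i-h_-^{(-i)}(x_{-i}))(x_i-h_+^{(-i)}(x_{-i}))$, and let $J_F$ be its Jacobian matrix with respect to $(x_i,x_{-i})$. A stable FNE is (locally) saddle if the eigenvalues of $J_F$ at it have opposite signs, i.e. $\det J_F<0$ at that point. *)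

(* Defs.v *)
From HB Require Import structures.
From mathcomp Require Import all_boot all_order all_algebra.
From mathcomp Require Import all_classical all_reals all_analysis.
Set Implicit Arguments.
Unset Strict Implicit.
Unset Printing Implicit Defensive.
Import Order.TTheory GRing.Theory Num.Theory.
Import numFieldNormedType.Exports.
Local Open Scope ring_scope.

(* The players 1, 2 are the two elements of 'I_2, and -i is [opponent i]. In all
   two-policy functions below, the policy y of the player under consideration
   comes first and the policy z of the other player second. *)
Notation player := 'I_2.
Definition opponent (i : player) : player := rev_ord i.

Section ScalarLQGame.
Variables (R : realType) (a gamma : R) (sigma r : player -> R).

Definition closed_loop (y z : R) : R := a + y + z.

Fixpoint state (s0 y z : R) (t : nat) : R :=
  if t is t'.+1 then
    let s := state s0 y z t' in a * s + y * s + z * s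
  else s0.

Definition value (i : player) (s0 y z : R) : \bar R :=
  (\sum_(0 <= t <oo)
     (gamma ^+ t * r i *
      (sigma i * state s0 y z t ^+ 2 + (y * state s0 y z t) ^+ 2))%:E)%E.

Definition feedback_nash (x : player -> R) : Prop :=
  forall (s0 : R) (i : player) (y : R),
    (value i s0 (x i) (x (opponent i)) <= value i s0 y (x (opponent i)))%E.

Definition stable_feedback_nash (x : player -> R) : Prop :=
  feedback_nash x /\
  forall i : player, `|closed_loop (x i) (x (opponent i))| < 1.

(* Only meaningful for y != 0. *)
Definition hminus (i : player) (y : R) : R :=
  (sigma i - y * (2 * a + y)) / (2 * y)
  - Num.sqrt (gamma ^+ 2 * (sigma i + y ^+ 2) ^+ 2 + 4 * gamma * y ^+ 2)
    / (2 * gamma * y).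

Definition hplus (i : player) (y : R) : R :=
  (sigma i - y * (2 * a + y)) / (2 * y)
  + Num.sqrt (gamma ^+ 2 * (sigma i + y ^+ 2) ^+ 2 + 4 * gamma * y ^+ 2)
    / (2 * gamma * y).

Definition Fcomp (i : player) (y z : R) : R :=
  gamma * y * (z - hminus i y) * (z - hplus i y).

(* (F_i, F_{-i}) as a function of the row vector w = (x_i, x_{-i}). *)
Definition Fmap (i : player) (w : 'rV[R]_2) : 'rV[R]_2 :=
  \row_(k < 2) if k == 0 then Fcomp i (w 0 0) (w 0 1)
               else Fcomp (opponent i) (w 0 1) (w 0 0).

Definition profile (i : player) (x : player -> R) : 'rV[R]_2 :=
  \row_(k < 2) if k == 0 then x i else x (opponent i).

(* [jacobian f p] acts on row vectors, v *m jacobian f p = 'd f p v, and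
   [eigenvalue] refers to row eigenvectors, so these are the eigenvalues of the
   differential of F. Since the matrix is 2 x 2, l and m are all of them. *)
Definition locally_saddle (i : player) (x : player -> R) : Prop :=
  let J := jacobian (Fmap i) (profile i x) in
  exists l m : R, [/\ eigenvalue J l, eigenvalue J m, l < 0 & 0 < m].

Definition Ccoef (i : player) (y z : R) : R :=
  (hminus i)^`()%classic y * (hminus (opponent i))^`()%classic z - 1.

End ScalarLQGame.

(* Main.v *)
Require Import Defs.
From HB Require Import structures.
From mathcomp Require Import all_boot all_order all_algebra.
From mathcomp Require Import all_classical all_reals all_analysis.
From mathcomp Require Import ring lra.
Import Order.TTheory GRing.Theory Num.Theory.
Import numFieldNormedType.Exports.
Local Open Scope ring_scope.

(** Write c for the closed-loop coefficient, y for the policy of one player, z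
    for that of the other, and S for the square root appearing in h_- and h_+.

    Against a fixed z the value of the policy y is a geometric series, equal to
    r (sigma + y^2) / (1 - gamma c^2) when gamma c^2 < 1 and s_0 = 1.  At a
    stable equilibrium y is an interior minimum of this quotient, and the
    first-order condition (lemma nash_stationary) is
      y (1 - gamma c^2) + gamma c (sigma + y^2) = 0,
    a quadratic equation in c whose two roots have product - 1 / gamma.
    Stability selects the root of smaller modulus, that is, z = h_-(y) rather
    than z = h_+(y) (lemma stationary_hminus).

    Hence both components of F vanish at the equilibrium through the same
    factor z - h_-(y), and the product rule retains only the derivative of that
    factor: with gamma y (h_- - h_+) = - S, the gradient of F_i at the
    equilibrium is - S times that of z - h_-(y).  With subscripts 1 and 2 for
    the players i and -i, the Jacobian is, up to transposition,
      [ S_1 h_-'(y)     - S_1     ]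
      [   - S_2       S_2 h_-'(z) ],
    so its determinant is S_1 S_2 C (lemma det_jacobian_Fmap), with S_1 and
    S_2 positive.  It remains to note that a real 2 x 2 matrix has one negative
    and one positive eigenvalue exactly when its determinant is negative (lemma
    eigenvalues_opposite_signP). *)

(** * Eigenvalues of 2 x 2 matrices *)

Lemma det2E (R : comNzRingType) (M : 'M[R]_2) :
  \det M = M 0 0 * M 1 1 - M 0 1 * M 1 0.
Proof.
rewrite (expand_det_row _ 0) !big_ord_recl big_ord0 addr0 /cofactor !det_mx11.
rewrite !mxE /= expr0 expr1 mul1r mulN1r mulrN.
by congr (M _ _ * M _ _ - M _ _ * M _ _); apply: val_inj.
Qed.

Lemma eigenvalue_det (F : fieldType) n (M : 'M[F]_n) (l : F) :
  eigenvalue M l = (\det (M - l%:M) == 0).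
Proof.
rewrite /eigenvalue /eigenspace kermx_eq0 row_free_unit unitmxE unitfE.
by rewrite negbK.
Qed.

Lemma eigenvalue2E (F : fieldType) (M : 'M[F]_2) (l : F) :
  eigenvalue M l = (l ^+ 2 - \tr M * l + \det M == 0).
Proof.
rewrite eigenvalue_det !det2E /mxtrace !big_ord_recl big_ord0 !mxE /=.
have -> : lift ord0 ord0 = 1 :> 'I_2 by apply: val_inj.
have -> : ord0 = 0 :> 'I_2 by apply: val_inj.
by congr (_ == 0); ring.
Qed.

(** The determinant is the product of the two roots l and m of the
    characteristic polynomial.  Conversely a negative determinant makes the
    discriminant exceed the square of the trace, so the roots are real and lie
    on both sides of 0. *)
Lemma eigenvalues_opposite_signP (R : rcfType) (M : 'M[R]_2) :
  (exists l m : R, [/\ eigenvalue M l, eigenvalue M m, l < 0 & 0 < m]) <->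
  \det M < 0.
Proof.
split=> [[l [m []]]|d_lt0].
  rewrite !eigenvalue2E => /eqP El /eqP Em l0 m0.
  (* Eliminating the trace between the two equations gives Vieta's formula for
     the product, as soon as l and m differ. *)
  have : (m - l) * (\det M - l * m) = 0.
    transitivity (m * (l ^+ 2 - \tr M * l + \det M)
      - l * (m ^+ 2 - \tr M * m + \det M)); first by ring.
    by rewrite El Em !mulr0 subr0.
  move/eqP; rewrite mulf_eq0 subr_eq0 => /orP[/eqP ml|]; first lra.
  by rewrite subr_eq0 => /eqP ->; nra.
move: d_lt0; set t := \tr M; set d := \det M => d_lt0.
have D_ge0 : 0 <= t ^+ 2 - 4 * d by have := sqr_ge0 t; lra.
set s := Num.sqrt (t ^+ 2 - 4 * d).
have sE : s ^+ 2 = t ^+ 2 - 4 * d by rewrite sqr_sqrtr.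
have s_ge0 : 0 <= s by exact: sqrtr_ge0.
have /ltr_normlP[Nt_lt_s t_lt_s] : `|t| < s.
  by rewrite -(@ltr_pXn2r _ 2) ?nnegrE // real_normK ?num_real // sE; lra.
exists ((t - s) / 2), ((t + s) / 2).
by split; rewrite ?eigenvalue2E -/t -/d; [apply/eqP; nra..|lra|lra].
Qed.

(** * Differentials and Jacobians *)

Lemma differentiable_row (R : realFieldType) (V : normedModType R) n
    (f : 'I_n -> V -> R) (p : V) :
  (forall k, differentiable (f k) p) ->
  differentiable (fun w => \row_k f k w) p.
Proof.
move=> df.
have -> : (fun w => \row_k f k w) = \sum_k (fun w => f k w *: 'e_k).
  apply/funext => w; rewrite fct_sumE [LHS]row_sum_delta.
  by apply: eq_bigr => k _; rewrite mxE.
by apply: differentiable_sum => k; exact: differentiableZl.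
Qed.

(** In the row-vector convention the first index of the Jacobian is the
    direction and the second one the component: this is the transpose of the
    usual layout. *)
Lemma jacobian_rowE (R : realFieldType) m n (f : 'I_n -> 'rV[R]_m -> R) p j k :
  (forall k, differentiable (f k) p) ->
  jacobian (fun w => \row_k f k w) p j k = 'd (f k) p 'e_j.
Proof.
move=> df; have dF := @differentiable_row _ _ _ _ _ df.
transitivity ((('e_j : 'rV_m) *m jacobian (fun w => \row_k f k w) p) 0 k).
  by rewrite -rowE [RHS]mxE.
rewrite -deriveEjacobian // derive_mx; last exact: diff_derivable.
rewrite mxE -deriveE //.
by have -> : (fun w => (\row_k0 f k0 w) 0 k) = f k by apply/funext => w; rewrite mxE.
Qed.

Lemma is_diff_coord (R : numFieldType) m n (p : 'M[R]_(m, n)) i j :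
  is_diff p (fun w : 'M[R]_(m, n) => w i j : R) (fun v => v i j).
Proof.
have lin : linear (fun w : 'M[R]_(m, n) => w i j : R).
  by move=> c u v; rewrite !mxE.
pose f : {linear 'M[R]_(m, n) -> R} :=
  HB.pack (fun w : 'M[R]_(m, n) => w i j : R)
          (GRing.isLinear.Build _ _ _ _ _ lin).
have fc : continuous f by exact: coord_continuous.
have -> : (fun w : 'M[R]_(m, n) => w i j : R) = f by [].
apply: DiffDef; first exact: linear_differentiable.
by rewrite diff_lin.
Qed.

(** At a zero of one factor of a product, only the term of the product rule that
    differentiates this factor survives: the derivative of [hp] disappears. *)
Lemma is_diff_product_at_root (R : numFieldType) n (g : R) (hm hp : R -> R)
    (p : 'rV[R]_n) (j k : 'I_n) :
  derivable hm (p 0 j) 1 -> derivable hp (p 0 j) 1 -> p 0 k = hm (p 0 j) ->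
  is_diff p
    (fun w : 'rV[R]_n =>
       g * w 0 j * (w 0 k - hm (w 0 j)) * (w 0 k - hp (w 0 j)))
    (fun v => g * p 0 j * (p 0 k - hp (p 0 j)) *
       (v 0 k - hm^`()%classic (p 0 j) * v 0 j)).
Proof.
move=> /derivable1_diffP dhm /derivable1_diffP dhp root.
have dj := @is_diff_coord R 1 n p 0 j.
have dk := @is_diff_coord R 1 n p 0 k.
have dm := differentiableP dhm; have dp := differentiableP dhp.
have dmj := @is_diff_comp _ _ _ _ _ _ _ _ _ dj dm.
have dpj := @is_diff_comp _ _ _ _ _ _ _ _ _ dj dp.
have H := is_diffM (is_diffM (is_diffZ g dj) (is_diffB dk dmj)) (is_diffB dk dpj).
apply: is_diff_eq H _; rewrite (diff1E dhm) (diff1E dhp).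
apply/funext => v.
(* The expanded product rule, whose first and last terms vanish at the root. *)
transitivity
  (g * p 0 j * (p 0 k - hm (p 0 j)) *
     (v 0 k - v 0 j * hp^`()%classic (p 0 j)) +
   (p 0 k - hp (p 0 j)) *
     (g * p 0 j * (v 0 k - v 0 j * hm^`()%classic (p 0 j)) +
      (p 0 k - hm (p 0 j)) * (g * v 0 j))); first by [].
by rewrite root; ring.
Qed.

(** * First-order condition at a stable equilibrium *)

(** First-order optimality in polynomial form.  Clearing denominators in the
    comparison of two values gives a quadratic in the deviation [t], so that no
    derivative of the value function is needed. *)
Lemma quadratic_linear_term_eq0 (R : realFieldType) (G K d : R) :
  0 < d -> d <= 1 -> 0 <= K ->
  (forall t, `|t| < d -> 0 <= 2 * t * G + t ^+ 2 * K) -> G = 0.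
Proof.
move=> d_gt0 d_le1 K_ge0 H; apply/eqP; apply: contraT => G_neq0.
have G_gt0 : 0 < `|G| by rewrite normr_gt0.
(* The test point t = - e G makes the linear term - 2 e G^2; this e is small
   enough both for |t| < d and for the quadratic term not to compensate it. *)
set e := d / (1 + `|G| + K).
have den_gt0 : 0 < 1 + `|G| + K by lra.
have e_gt0 : 0 < e by rewrite divr_gt0.
have eE : e * (1 + `|G| + K) = d by rewrite /e divfK // gt_eqF.
have eG_lt : e * `|G| < d by nra.
have eK_lt1 : e * K < 1 by nra.
have := H (- (e * G)); rewrite normrN normrM (gtr0_norm e_gt0) => /(_ eG_lt).
have -> : 2 * - (e * G) * G + (- (e * G)) ^+ 2 * K =
  - (e * G ^+ 2) * (2 - e * K) by ring.
have G2_gt0 : 0 < G ^+ 2 by rewrite exprn_even_gt0.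
have eG2_gt0 : 0 < e * G ^+ 2 by rewrite mulr_gt0.
have eK_lt2 : 0 < 2 - e * K by lra.
by rewrite mulNr oppr_ge0 leNgt mulr_gt0.
Qed.

Lemma opponentK : involutive opponent.
Proof. exact: rev_ordK. Qed.

Section Game.
Variables (R : realType) (a gamma : R) (sigma r : player -> R).

Lemma stateE (s0 y z : R) t : state a s0 y z t = closed_loop a y z ^+ t * s0.
Proof.
by elim: t => [|t IH] /=; rewrite ?mul1r // IH exprS /closed_loop; ring.
Qed.

Lemma value1E i (y z : R) :
  0 <= gamma -> gamma * closed_loop a y z ^+ 2 < 1 ->
  value a gamma sigma r i 1 y z =
  (r i * (sigma i + y ^+ 2) / (1 - gamma * closed_loop a y z ^+ 2))%:E.
Proof.
move=> g_ge0; set q := gamma * _ => q_lt1.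
have /cvg_geometric_series H : `|q| < 1.
  by rewrite ger0_norm // mulr_ge0 // sqr_ge0.
have {}H := H (r i * (sigma i + y ^+ 2)).
rewrite -(cvg_lim _ H) // -EFin_lim; last by apply/cvgP; exact: H.
rewrite /value; congr (limn _); apply/funext => n /=.
rewrite /series /= -sumEFin; apply: eq_bigr => t _; congr (_%:E).
rewrite /geometric /= stateE mulr1.
have -> : q ^+ t = gamma ^+ t * (closed_loop a y z ^+ t) ^+ 2.
  by rewrite /q exprMn -!exprM mulnC.
by ring.
Qed.

Lemma discounted_sqr_lt1 (u : R) :
  gamma <= 1 -> `|u| < 1 -> gamma * u ^+ 2 < 1.
Proof.
move=> g_le1 u_lt1; have : `|u| ^+ 2 < 1 by rewrite expr_lt1.
by rewrite real_normK ?num_real // => u2_lt1; have := sqr_ge0 u; nra.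
Qed.

(** Deviations [t] with |c + t| < 1 keep both values finite, and the inequality
    between these two fractions becomes polynomial in [t] once the positive
    denominators are cleared; its linear coefficient has to vanish. *)
Lemma nash_stationary x i :
  0 < gamma -> gamma <= 1 -> 0 <= sigma i -> 0 < r i ->
  stable_feedback_nash a gamma sigma r x ->
  let c := closed_loop a (x i) (x (opponent i)) in
  x i * (1 - gamma * c ^+ 2) + gamma * c * (sigma i + x i ^+ 2) = 0.
Proof.
move=> g_gt0 g_le1 s_ge0 r_gt0 [nash /(_ i) stable] c.
rewrite -/c in stable.
set y := x i in c stable *; set z := x (opponent i) in c stable *.
have disc u : `|u| < 1 -> gamma * u ^+ 2 < 1 by exact: discounted_sqr_lt1.
have y2_ge0 := sqr_ge0 y.
have c_disc := disc _ stable.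
apply: (@quadratic_linear_term_eq0 _ _
  (1 - gamma * c ^+ 2 + gamma * (sigma i + y ^+ 2)) (1 - `|c|)).
- by rewrite subr_gt0.
- by rewrite lerBlDr lerDl.
- by nra.
move=> t t_lt.
have ct_lt1 : `|c + t| < 1.
  by apply: le_lt_trans (ler_normD _ _) _; lra.
have ctE : closed_loop a (y + t) z = c + t by rewrite /c /closed_loop; ring.
have := nash 1 i (y + t); rewrite -/y -/z.
rewrite !value1E ?ctE ?(ltW g_gt0) -/c ?disc //.
rewrite lee_fin ler_pdivrMr ?subr_gt0 ?disc //.
rewrite mulrAC ler_pdivlMr ?subr_gt0 ?disc //.
rewrite -!mulrA ler_pM2l //.
nra.
Qed.

(** * The branches h_- and h_+ *)

(** The discriminant of the first-order condition, seen as a quadratic equation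
    in the closed-loop coefficient. *)
Definition discriminant (i : player) (y : R) : R :=
  gamma ^+ 2 * (sigma i + y ^+ 2) ^+ 2 + 4 * gamma * y ^+ 2.

Lemma discriminant_gt0 i (y : R) :
  0 < gamma -> y != 0 -> 0 < discriminant i y.
Proof.
move=> g_gt0 y_neq0; have y2_gt0 : 0 < y ^+ 2 by rewrite exprn_even_gt0.
apply: ltr_wpDl; first by rewrite mulr_ge0 ?sqr_ge0.
by apply: mulr_gt0 => //; exact: mulr_gt0.
Qed.

Lemma hminus_hplusB i (y : R) : 0 < gamma -> y != 0 ->
  gamma * y * (hminus a gamma sigma i y - hplus a gamma sigma i y) =
  - Num.sqrt (discriminant i y).
Proof.
move=> g_gt0 y_neq0; rewrite /hminus /hplus -/(discriminant i y).
by field; rewrite y_neq0 gt_eqF.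
Qed.

Lemma derivable_hminus_hplus i (y : R) : 0 < gamma -> y != 0 ->
  derivable (hminus a gamma sigma i) y 1 /\
  derivable (hplus a gamma sigma i) y 1.
Proof.
move=> g_gt0 y_neq0.
have dc (c : R) : derivable (cst c) y 1 by exact: derivable_cst.
have di : derivable (@idfun R) y 1 by exact: derivable_id.
have dX : derivable (fun u : R => u ^+ 2) y 1 by exact: exprn_derivable.
have dV (c : R) : c != 0 -> derivable (fun u : R => (c * u)^-1) y 1.
  move=> c_neq0; apply: (@derivableV _ _ (cst c * idfun)).
    by rewrite mulf_neq0.
  exact: derivableM (dc c) di.
have dA : derivable
    (fun u : R => (sigma i - u * (2 * a + u)) / (2 * u)) y 1.
  have dN := derivableB (dc (sigma i)) (derivableM di (derivableD (dc (2 * a)) di)).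
  by apply: (derivableM dN (dV 2 _)); rewrite pnatr_eq0.
have dD : derivable (discriminant i) y 1.
  have dB2 := derivableX (n := 2%N) (derivableD (dc (sigma i)) dX).
  exact: (derivableD (derivableM (dc (gamma ^+ 2)) dB2)
                     (derivableM (dc (4 * gamma)) dX)).
have dS : derivable
    (fun u : R => Num.sqrt (discriminant i u) / (2 * gamma * u)) y 1.
  have dsqrt : derivable (Num.sqrt \o discriminant i) y 1.
    apply/derivable1_diffP/differentiable_comp; first exact/derivable1_diffP.
    apply/derivable1_diffP.
    by have [] := is_derive1_sqrt (discriminant_gt0 i _ g_gt0 y_neq0).
  apply: (derivableM dsqrt (dV (2 * gamma) _)).
  by rewrite mulf_neq0 ?pnatr_eq0 // gt_eqF.
by split; [exact: derivableB dA dS|exact: derivableD dA dS].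
Qed.

(** Why the equilibrium lies on h_- and not on h_+: the first-order condition
    and [gamma * c ^+ 2 < 1] force y and c to have opposite signs, which fixes
    the sign of the square root of the discriminant. *)
Lemma stationary_hminus i (y z : R) :
  0 < gamma -> 0 <= sigma i -> y != 0 ->
  let c := closed_loop a y z in
  gamma * c ^+ 2 < 1 ->
  y * (1 - gamma * c ^+ 2) + gamma * c * (sigma i + y ^+ 2) = 0 ->
  z = hminus a gamma sigma i y.
Proof.
move=> g_gt0 s_ge0 y_neq0 c c_disc G0.
have B_gt0 : 0 < sigma i + y ^+ 2.
  by apply: ltr_wpDl => //; rewrite exprn_even_gt0.
have yc_le0 : y * c <= 0.
  rewrite -(pmulr_lle0 _ (_ : 0 < 1 - gamma * c ^+ 2)) ?subr_gt0 //.
  (* This is c times the first-order condition. *)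
  have -> : y * c * (1 - gamma * c ^+ 2) =
      - (gamma * c ^+ 2 * (sigma i + y ^+ 2)).
    by apply/eqP; rewrite -addr_eq0 -[X in _ == X](mulr0 c) -G0; apply/eqP; ring.
  have gc_ge0 : 0 <= gamma * c ^+ 2 by rewrite mulr_ge0 ?sqr_ge0 ?ltW.
  by rewrite oppr_le0 mulr_ge0 // ltW.
have sqrtE : Num.sqrt (discriminant i y) =
    gamma * (sigma i + y ^+ 2) - 2 * gamma * (y * c).
  rewrite -[RHS]ger0_norm; last by nra.
  rewrite -sqrtr_sqr; congr Num.sqrt; rewrite /discriminant.
  apply/eqP; rewrite -subr_eq0; apply/eqP.
  by rewrite -[RHS](mulr0 (4 * gamma * y)) -G0; ring.
rewrite /hminus -/(discriminant i y) sqrtE /c /closed_loop.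
by field; rewrite y_neq0 gt_eqF.
Qed.

(** * The determinant of the Jacobian *)

(** On the branch z = h_-(y) the differential of a component of F is, up to the
    factor - S, that of z - h_-(y). *)
Lemma is_diff_Fcomp i (p : 'rV[R]_2) (j k : 'I_2) :
  0 < gamma -> p 0 j != 0 -> p 0 k = hminus a gamma sigma i (p 0 j) ->
  is_diff p
    (fun w : 'rV[R]_2 => Fcomp a gamma sigma i (w 0 j) (w 0 k))
    (fun v => - Num.sqrt (discriminant i (p 0 j)) *
       (v 0 k - (hminus a gamma sigma i)^`()%classic (p 0 j) * v 0 j)).
Proof.
move=> g_gt0 y_neq0 root.
have [dm dp] := @derivable_hminus_hplus i _ g_gt0 y_neq0.
apply: is_diff_eq.
  exact: (is_diff_product_at_root _ _ gamma _ _ _ _ _ dm dp root).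
by apply/funext => v; rewrite root hminus_hplusB.
Qed.

Lemma det_jacobian_Fmap i (p : 'rV[R]_2) :
  0 < gamma -> p 0 0 != 0 -> p 0 1 != 0 ->
  p 0 1 = hminus a gamma sigma i (p 0 0) ->
  p 0 0 = hminus a gamma sigma (opponent i) (p 0 1) ->
  \det (jacobian (Fmap a gamma sigma i) p) =
  Num.sqrt (discriminant i (p 0 0)) *
  Num.sqrt (discriminant (opponent i) (p 0 1)) *
  Ccoef a gamma sigma i (p 0 0) (p 0 1).
Proof.
move=> g_gt0 y_neq0 z_neq0 z_root y_root.
pose f (k : 'I_2) (w : 'rV[R]_2) := if k == 0
  then Fcomp a gamma sigma i (w 0 0) (w 0 1)
  else Fcomp a gamma sigma (opponent i) (w 0 1) (w 0 0).
have d0 : is_diff p (f 0) _ := is_diff_Fcomp _ _ _ _ g_gt0 y_neq0 z_root.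
have d1 : is_diff p (f 1) _ := is_diff_Fcomp _ _ _ _ g_gt0 z_neq0 y_root.
have df k : differentiable (f k) p by rewrite /f; case: (k == 0); exact: ex_diff.
have JE k l : jacobian (Fmap a gamma sigma i) p k l = 'd (f l) p 'e_k.
  exact: (jacobian_rowE _ _ _ f).
rewrite det2E !JE (@diff_val _ _ _ _ _ _ _ d0) (@diff_val _ _ _ _ _ _ _ d1).
by rewrite !mxE /= /Ccoef; ring.
Qed.

End Game.

(** * Characterization of the saddle equilibria *)

Theorem theorem5p1 (R : realType) (a gamma : R) (sigma r : player -> R)
    (a_neq0 : a != 0) (gamma_gt0 : 0 < gamma) (gamma_le1 : gamma <= 1)
    (sigma_ge0 : forall j : player, 0 <= sigma j)
    (r_gt0 : forall j : player, 0 < r j)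
    (x : player -> R) (x_neq0 : forall j : player, x j != 0)
    (x_fne : stable_feedback_nash a gamma sigma r x) (i : player) :
  locally_saddle a gamma sigma i x <->
  Ccoef a gamma sigma i (x i) (x (opponent i)) < 0.
Proof.
have root j : x (opponent j) = hminus a gamma sigma j (x j).
  apply: stationary_hminus => //; last exact: nash_stationary x_fne.
  exact: discounted_sqr_lt1 (x_fne.2 j).
have p0 : profile i x 0 0 = x i by rewrite mxE.
have p1 : profile i x 0 1 = x (opponent i) by rewrite mxE.
rewrite /locally_saddle /= eigenvalues_opposite_signP det_jacobian_Fmap ?p0 ?p1 //.
  by rewrite pmulr_rlt0 // mulr_gt0 // sqrtr_gt0 discriminant_gt0.
by rewrite -[in LHS](opponentK i).
Qed.
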